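(* Let $\{T_k\}$ be a sequence of NT-statistics built from functions $l_1,l_2,\ldots$ and the observations $Y_1,Y_2,\ldots$, and let $S$ be a selection rule for it with penalty $\pi$ and control sequence $d(n)$. Let $P$ be the alternative distribution of the $Y_i$'s. Suppose that: (1) there exists an integer $K=K(P)\ge 1$ such that $E_P\,l_1(Y)=0,\ldots,E_P\,l_{K-1}(Y)=0$ and $E_P\,l_K(Y)=C_P\neq 0$; (2) $\lim_{n\to\infty} d(n)=\infty$; (3) $\displaystyle \lim_{n\to\infty}\ \sup_{k\le d(n)} \frac{\pi(k,n)}{n\,\lambda^{(k)}_k}=0$. Then $$\lim_{n\to\infty} P(S\ge K)=1 .$$
   Context: Setting. $Y_1,Y_2,\ldots$ are random variables with values in a measurable space $\mathbb{Y}$ (not necessarily independent), and $l_1,l_2,\ldots:\mathbb{Y}\to\mathbb{R}$ are known measurable functions. $P_0$ is a fixed, known distribution of an auxiliary random variable $Y$ with values in $\mathbb{Y}$, and $E_0$ is expectation with respect to $P_0$. NT-statistics. For each $k$ put $l=(l_1,\ldots,l_k)$ (a row vector) and assume $E_0\,l(Y)=0$ and that the $k\times k$ matrix $L=L_k=\{E_0[l(Y)]^T l(Y)\}^{-1}$ is well defined with finite entries. The NT-statistic based on $Y_1,\ldots,Y_n$ is $$T_k=\Bigl\{\tfrac{1}{\sqrt n}\sum_{j=1}^n l(Y_j)\Bigr\}\,L_k\,\Bigl\{\tfrac{1}{\sqrt n}\sum_{j=1}^n l(Y_j)\Bigr\}^T .$$ The ordered eigenvalues of $L_k$ are $\lambda^{(k)}_1\ge\lambda^{(k)}_2\ge\cdots\ge\lambda^{(k)}_k$.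 Selection rule. $d(n)$ is a sequence of positive integers (the largest model dimension allowed with $n$ observations). A penalty is a function $\pi:\mathbb{N}\times\mathbb{N}\to\mathbb{R}$ with $\pi(1,n)<\pi(2,n)<\cdots<\pi(d(n),n)$ for all $n$ and $\pi(j,n)-\pi(1,n)\to\infty$ as $n\to\infty$ for every $j=2,\ldots,d(n)$. The selection rule $S$ is $$S=\min\{k:\ 1\le k\le d(n);\ T_k-\pi(k,n)\ge T_j-\pi(j,n),\ j=1,\ldots,d(n)\}.$$ Standing assumptions under the alternative. Under $P$ the variables $Y_1,Y_2,\ldots$ are identically distributed (not necessarily independent); $P$ also denotes probability under the alternative and $E_P$ the corresponding expectation; $E_P\,l(Y)$ exists. With $K$ as in (1) and $l=(l_1,\ldots,l_K)$, the law of large numbers and the multivariate central limit theorem hold: $\frac1n\sum_{j=1}^n l(Y_j)\to E_P\,l(Y)$ in $P$-probability, and $n^{-1/2}\sum_{j=1}^n\bigl(l(Y_j)-E_P\,l(Y)\bigr)\to_d\mathcal{N}$, where $\mathcal{N}$ is a $K$-dimensional normal distribution with zero mean vector.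
   Formalization: The formal theorem additionally assumes that for every ε>0, π(1,n) ≥ −εn for all large n (automatic for nonnegative penalties); without it the claim fails for signed penalties such as π(1,n) = −n², which can force S = 1. *)

(* Defs.v *)
From HB Require Import structures.
From mathcomp Require Import all_boot all_order all_algebra.
From mathcomp Require Import all_classical all_reals all_analysis.

(* MathComp world, with MathComp-Analysis. *)

Set Implicit Arguments.
Unset Strict Implicit.
Unset Printing Implicit Defensive.

Import Order.TTheory GRing.Theory Num.Theory.
Import numFieldNormedType.Exports.

Local Open Scope classical_set_scope.
Local Open Scope ring_scope.

(* Sequences l_1, l_2, ... and Y_1, Y_2, ... are functions on nat used at the
   indices >= 1 only; entry i : 'I_k of the row vector (l_1, ..., l_k) is
   therefore l_{i+1}. *)

Section NT_statistics.
Context (R : realType) (dY : measure_display) (YY : measurableType dY).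
Implicit Types (l : nat -> {mfun YY >-> R}) (k n : nat).

Definition lrow l k (y : YY) : 'rV[R]_k := \row_(i < k) l i.+1 y.

Definition second_moment_mx (P0 : probability YY R) l k : 'M[R]_k :=
  \matrix_(i < k, j < k) fine 'E_P0[fun y => (l i.+1 y * l j.+1 y)%R]%E.

Definition NT_mx (P0 : probability YY R) l k : 'M[R]_k := invmx (second_moment_mx P0 l k).

(* Since fine and invmx are total, well-definedness of NT_mx is the
   conjunction of the last two clauses. *)
Definition NT_admissible (P0 : probability YY R) l : Prop :=
  [/\ forall i, (0 < i)%N -> P0.-integrable setT (EFin \o l i),
      forall i, (0 < i)%N -> 'E_P0[l i]%E = 0%E,
      forall i j, (0 < i)%N -> (0 < j)%N ->
        P0.-integrable setT (EFin \o (fun y => l i y * l j y)) &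
      forall k, (0 < k)%N -> second_moment_mx P0 l k \in unitmx].

Definition normalized_sum l k (Y : nat -> YY) n : 'rV[R]_k :=
  (Num.sqrt n%:R)^-1 *: \sum_(1 <= j < n.+1) lrow l k (Y j).

Definition NT_stat (P0 : probability YY R) l (Y : nat -> YY) n k : R :=
  (normalized_sum l k Y n *m NT_mx P0 l k *m (normalized_sum l k Y n)^T) 0 0.

End NT_statistics.

(* The eigenvalues of A with multiplicity, in nonincreasing order.  The list is
   unique when it exists, and it exists whenever A is symmetric. *)
Definition ordered_eigenvalues (R : realType) (k : nat) (A : 'M[R]_k) : seq R :=
  xget [::] [set s : seq R | sorted >=%R s /\
                             char_poly A = \prod_(x <- s) ('X - x%:P)].

(* The i-th largest eigenvalue, 1 <= i <= k. *)
Definition ordered_eigenvalue (R : realType) (k : nat) (A : 'M[R]_k) (i : nat) : R :=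
  nth 0 (ordered_eigenvalues A) i.-1.

(* In the divergence clause j is fixed, and only those n for which j is an
   allowed dimension (j <= d n) are considered. *)
Definition is_penalty (R : realType) (d : nat -> nat) (pen : nat -> nat -> R) : Prop :=
  (forall n i j, (0 < n)%N -> (1 <= i)%N -> (i < j)%N -> (j <= d n)%N ->
     pen i n < pen j n) /\
  (forall j, (2 <= j)%N ->
     (pen j n - pen 1%N n) @[n --> within [set n | (j <= d n)%N] \oo] --> +oo).

(* The least k in {1, ..., d} that maximizes T k - pen k over {1, ..., d}; the
   default value 0 is only returned for d = 0. *)
Definition selection (R : realType) (T pen : nat -> R) (d : nat) : nat :=
  head 0%N [seq k <- iota 1 d | all (fun j => T j - pen j <= T k - pen k) (iota 1 d)].

Definition cvg_in_probability (R : realType) (dO : measure_display)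
    (Omega : measurableType dO) (P : probability Omega R) (V : normedModType R)
    (X : nat -> Omega -> V) (x : V) : Prop :=
  forall e : R, 0 < e ->
    P [set w | e <= `|X n w - x|] @[n --> \oo] --> 0%E.

(* Weak convergence, tested on bounded continuous functions; the limit lives on
   its own probability space. *)
Definition cvg_in_law (R : realType) (dO dO' : measure_display)
    (Omega : measurableType dO) (P : probability Omega R)
    (Omega' : measurableType dO') (P' : probability Omega' R)
    (V : normedModType R) (X : nat -> Omega -> V) (Z : Omega' -> V) : Prop :=
  forall f : V -> R, continuous f -> (exists M, forall x, `|f x| <= M) ->
    'E_P[f \o X n]%E @[n --> \oo] --> 'E_P'[f \o Z]%E.

(* N(0, s^2); normal_prob 0 0 is not the Dirac mass, so the degenerate case is
   treated apart. *)
Definition centered_normal (R : realType) (s : R) (A : set R) : \bar R :=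
  if s == 0 then \d_(0 : R) A else normal_prob 0 s A.

(* Z is a normal vector with zero mean: every linear combination of its
   coordinates is a centered (possibly degenerate) normal variable. *)
Definition centered_normal_vector (R : realType) (dO : measure_display)
    (Omega : measurableType dO) (P : probability Omega R) (k : nat)
    (Z : Omega -> 'rV[R]_k) : Prop :=
  (forall i, measurable_fun setT (fun w => Z w 0 i)) /\
  (forall a : 'rV[R]_k, exists s : R, forall A : set R, measurable A ->
     P [set w | A (\sum_(i < k) a 0 i * Z w 0 i)] = centered_normal s A).

(* Main.v *)
Require Import Defs.
From HB Require Import structures.
From mathcomp Require Import all_boot all_order all_algebra.
From mathcomp Require Import all_classical all_reals all_analysis.
From mathcomp Require Import measurable_realfun complex ring lra.

Import Order.TTheory GRing.Theory Num.Theory.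
Import numFieldNormedType.Exports.

Local Open Scope classical_set_scope.
Local Open Scope ring_scope.

(** The law of large numbers separates the models.  Write x for the mean of the
    vectors (l_1, ..., l_K)(Y_j) over j = 1, ..., n, and L_k for NT_mx.
    Then T_k = n * q_k(x), where q_k(x) is the quadratic form of the matrix L_k
    at the first k entries of x (NT_stat_mean).  The matrix L_k is the inverse
    of an invertible Gram matrix, hence positive definite
    (NT_mx_quad_form_gt0).  At the limit mu of x, whose only nonzero entry is
    the last one, c := q_K(mu) is positive while q_k(mu) = 0 for k < K.  By
    continuity of the finitely many q_k, there is a ball around mu on which
    q_K - q_k > c / 2 for all k < K, so that T_K beats T_k by n * c / 2 as soon
    as x lies in this ball, an event whose probability tends to 1.

    The penalties cannot compensate this gap.  As the smallest eigenvalue of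
    L_K is positive, the hypothesis on the supremum, used at the single index
    K, bounds pen K n by n * c / 4 from above, and monotonicity bounds pen k n
    by pen 1 n >= - n * c / 4 from below.  Hence, for n large, each k < K is
    strictly beaten by K on the event above, and S >= K there (leq_selection).

    That the smallest eigenvalue of L_K is positive has two sides:
    ordered_eigenvalues has a meaningful value only if the characteristic
    polynomial splits over the reals, which is the spectral theorem for real
    symmetric matrices (char_poly_sym_split, through the complex numbers); and
    real eigenvalues of the inverse of a positive definite matrix are positive
    (eigenvalue_invmx_gt0). *)

(** * Real symmetric matrices and quadratic forms *)

Definition quad_form {R : pzRingType} {k} (A : 'M[R]_k) (v : 'rV[R]_k) : R :=
  (v *m A *m v^T) 0 0.

Lemma quad_formE {R : pzRingType} {k} (A : 'M[R]_k) (v : 'rV[R]_k) :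
  quad_form A v = \sum_j (\sum_i v 0 i * A i j) * v 0 j.
Proof. by rewrite /quad_form !mxE; apply: eq_bigr => j _; rewrite !mxE. Qed.

Lemma quad_form0 {R : pzRingType} {k} (A : 'M[R]_k) : quad_form A 0 = 0.
Proof. by rewrite /quad_form !mul0mx mxE. Qed.

Lemma quad_formZ {R : comPzRingType} {k} (A : 'M[R]_k) a (v : 'rV[R]_k) :
  quad_form A (a *: v) = a ^+ 2 * quad_form A v.
Proof.
by rewrite /quad_form [(a *: v)^T]linearZ /= -!scalemxAl -scalemxAr scalerA mxE.
Qed.

(** The conjugate is essential: over the complex numbers, v v^T may vanish for a
    nonzero v. *)
Lemma mulmx_conj_tr_neq0 {C : numClosedFieldType} {k} (v : 'rV[C]_k) :
  v != 0 -> (v *m (map_mx Num.conj v)^T) 0 0 != 0.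
Proof.
apply: contraNneq; rewrite mxE => vv0; apply/eqP/rowP => i; rewrite mxE.
have := @psumr_eq0P _ _ xpredT (fun i => v 0 i * (map_mx Num.conj v)^T i 0) _ vv0.
move=> /(_ _ i isT); rewrite !mxE => /(_ _)/eqP.
rewrite mulf_eq0 conjC_eq0 orbb => H; apply/eqP/H => j _.
by rewrite !mxE mul_conjC_ge0.
Qed.

Lemma mulmx_tr_gt0 {R : realFieldType} {k} (v : 'rV[R]_k) :
  v != 0 -> 0 < (v *m v^T) 0 0.
Proof.
have ge0 i : true -> 0 <= v 0 i * v^T i 0 by rewrite mxE -expr2 sqr_ge0.
move=> v0; rewrite lt_neqAle mxE sumr_ge0 // andbT eq_sym.
apply: contra_neq v0 => /(psumr_eq0P ge0) H; apply/rowP => i.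
by have /eqP := H i isT; rewrite !mxE mulf_eq0 orbb => /eqP.
Qed.

(** If v A = a v with A real and symmetric then, with w the conjugate of v,
    w A = a^* w, and computing v A w^T on both sides gives
    a (v w^T) = a^* (v w^T) with v w^T nonzero. *)
Lemma eigenvalue_sym_real {R : rcfType} {k} (A : 'M[R]_k) (a : R[i]) :
  A^T = A -> eigenvalue (map_mx (real_complex R) A) a -> a \is Num.real.
Proof.
move=> symA /eigenvalueP[v vA v0].
pose AC := map_mx (real_complex R) A; pose w := map_mx Num.conj v.
have symAC : AC^T = AC by rewrite /AC map_trmx symA.
have wA : w *m AC = a^* *: w.
  rewrite -map_mxZ -vA map_mxM; congr (_ *m _); apply/matrixP => i j.
  by rewrite !mxE; apply/esym/CrealP/complex_realP; exists (A i j).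
have : a *: (v *m w^T) = a^* *: (v *m w^T).
  rewrite scalemxAl -vA -mulmxA -[AC *m _]trmxK trmx_mul symAC trmxK wA.
  by rewrite linearZ /= scalemxAr.
move=> /matrixP/(_ 0 0); rewrite [LHS]mxE [RHS]mxE.
by move=> /(mulIf (mulmx_conj_tr_neq0 v v0))/esym/CrealP.
Qed.

(** The complex roots of the characteristic polynomial are real, so its
    factorization over the complex numbers descends. *)
Lemma char_poly_sym_split {R : rcfType} {k} (A : 'M[R]_k) : A^T = A ->
  exists s : seq R, char_poly A = \prod_(x <- s) ('X - x%:P).
Proof.
move=> symA; pose AC := map_mx (real_complex R) A.
have [r] := closed_field_poly_normal (char_poly AC).
rewrite (monicP (char_poly_monic _)) scale1r => rP.
exists [seq complex.Re z | z <- r]; apply: (map_poly_inj (real_complex R)).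
rewrite map_char_poly rP rmorph_prod big_map; apply: eq_big_seq => z zr.
rewrite /= rmorphB /= map_polyX map_polyC /= RRe_real //.
apply: (eigenvalue_sym_real A) => //.
by rewrite eigenvalue_root_char rP root_prod_XsubC.
Qed.

(** Symmetry guarantees that the list ordered_eigenvalues exists, rather than
    being the default empty list, and that it has length k. *)
Lemma eigenvalue_ordered_eigenvalue {R : realType} {k} (A : 'M[R]_k) i :
  A^T = A -> (0 < i <= k)%N -> eigenvalue A (ordered_eigenvalue A i).
Proof.
move=> symA /andP[i0 ik]; rewrite eigenvalue_root_char /ordered_eigenvalue.
have [s sA] := char_poly_sym_split A symA.
have [_ eA] : sorted >=%R (ordered_eigenvalues A) /\
    char_poly A = \prod_(x <- ordered_eigenvalues A) ('X - x%:P).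
  apply: (@xgetPex _ [::] [set s : seq R | sorted >=%R s /\
    char_poly A = \prod_(x <- s) ('X - x%:P)]); exists (sort >=%R s); split.
    by apply: sort_sorted => x y; apply: le_total.
  by rewrite sA; apply: perm_big; rewrite perm_sym perm_sort.
rewrite {1}eA root_prod_XsubC mem_nth //.
have := size_char_poly A; rewrite {1}eA size_prod_XsubC => -[->].
by case: i i0 ik.
Qed.

Section positive_forms.
Context {R : realFieldType} {k : nat} (M : 'M[R]_k).
Context (symM : M^T = M) (unitM : M \in unitmx).
Context (psdM : forall v, 0 <= quad_form M v).

Lemma invmx_sym : (invmx M)^T = invmx M.
Proof. by rewrite trmx_inv symM. Qed.

(** If u M u^T = 0, then t |-> (u + t w) M (u + t w)^T is nonnegative and
    vanishes at 0, so its derivative 2 (u M w^T) is 0 there.  For w = u M this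
    says u M = 0, hence u = 0 as M is invertible. *)
Lemma quad_form_gt0 (u : 'rV[R]_k) : u != 0 -> 0 < quad_form M u.
Proof.
move=> u0; rewrite lt_neqAle psdM andbT eq_sym; apply: contra_neq u0 => uMu0.
pose w := u *m M; pose b := (w *m w^T) 0 0; pose c := quad_form M w.
have key t : 0 <= 2 * t * b + t ^+ 2 * c.
  have := psdM (u + t *: w).
  rewrite /quad_form linearD /= linearZ /= !mulmxDl !mulmxDr.
  rewrite -!scalemxAl -!scalemxAr.
  have eD (B C : 'M[R]_1) : (B + C) 0 0 = B 0 0 + C 0 0 by rewrite mxE.
  have eZ x (B : 'M[R]_1) : (x *: B) 0 0 = x * B 0 0 by rewrite mxE.
  rewrite !eD !eZ -/(quad_form M u) uMu0.
  have -> : (u *m M *m w^T) 0 0 = b by [].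
  have -> : (w *m M *m u^T) 0 0 = b.
    by rewrite -mulmxA -[M]symM -trmx_mul.
  rewrite -/(quad_form M w) -/c; lra.
have c0 : 0 <= c := psdM w.
have b0 : b <= 0.
  rewrite leNgt; apply/negP => b0.
  (* The bound in key is minimal at t = - b / c; taking 1 + c for c still makes
     it negative and covers the case c = 0. *)
  have := key (- (b / (1 + c))).
  have c1 : 0 < 1 + c by lra.
  rewrite leNgt => /negP; apply.
  have -> : 2 * - (b / (1 + c)) * b + (- (b / (1 + c))) ^+ 2 * c =
    - (b / (1 + c)) ^+ 2 * (2 + c) by field; lra.
  by rewrite mulNr oppr_lt0 mulr_gt0 ?exprn_gt0 ?divr_gt0 //; lra.
have w0 : w = 0 by apply: contraTeq b0 => /mulmx_tr_gt0; rewrite ltNge.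
by rewrite -[u](mulmxK unitM) -/w w0 mul0mx.
Qed.

Lemma quad_form_invmx_gt0 (u : 'rV[R]_k) : u != 0 -> 0 < quad_form (invmx M) u.
Proof.
move=> u0; have -> : quad_form (invmx M) u = quad_form M (u *m invmx M).
  by rewrite /quad_form mulmxKV // trmx_mul invmx_sym mulmxA.
apply: quad_form_gt0; apply: contra_neq u0 => uM0.
by rewrite -[u](mulmxKV unitM) uM0 mul0mx.
Qed.

Lemma eigenvalue_invmx_gt0 a : eigenvalue (invmx M) a -> 0 < a.
Proof.
move=> /eigenvalueP[v vM v0]; have := quad_form_invmx_gt0 v v0.
rewrite /quad_form vM -scalemxAl mxE pmulr_lgt0 //; exact: mulmx_tr_gt0.
Qed.

End positive_forms.

(** * Second moment matrices *)

Lemma Rintegral_sum {d : measure_display} {T : measurableType d} {R : realType}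
    (mu : {measure set T -> \bar R}) (I : Type) (s : seq I) (h : I -> T -> R) :
  (forall i, mu.-integrable setT (EFin \o h i)) ->
  \int[mu]_x (\sum_(i <- s) h i x) = \sum_(i <- s) \int[mu]_x h i x.
Proof.
move=> ih; rewrite /Rintegral.
under eq_integral do rewrite -sumEFin.
rewrite (integral_sum measurableT ih) -sum_fine // => i _.
exact: integrable_fin_num (ih i).
Qed.

Section second_moments.
Context {R : realType} {dY : measure_display} {YY : measurableType dY}.
Context (P0 : probability YY R) (l : nat -> {mfun YY >-> R}).

Lemma second_moment_mx_sym k : (second_moment_mx P0 l k)^T = second_moment_mx P0 l k.
Proof.
apply/matrixP => i j; rewrite !mxE; congr (fine 'E_P0[_]).
by apply/funext => y; rewrite mulrC.
Qed.

(** The second moment matrix is the Gram matrix of l_1, ..., l_k for the inner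
    product E_0[f g], whence its positivity. *)
Lemma quad_form_second_moment k (v : 'rV[R]_k) : NT_admissible P0 l ->
  quad_form (second_moment_mx P0 l k) v =
  \int[P0]_y ((\sum_(i < k) v 0 i * l i.+1 y) ^+ 2).
Proof.
move=> [_ _ il _].
have ill (a : R) (i j : 'I_k) :
    P0.-integrable setT (EFin \o (fun y => a * (l i.+1 y * l j.+1 y))).
  by apply: (integrableZl measurableT a (il i.+1 j.+1 _ _)).
have sqr_expand y : (\sum_(i < k) v 0 i * l i.+1 y) ^+ 2 =
    \sum_j \sum_i (v 0 i * v 0 j) * (l i.+1 y * l j.+1 y).
  rewrite expr2 mulr_sumr; apply: eq_bigr => j _; rewrite mulr_suml.
  by apply: eq_bigr => i _; ring.
rewrite quad_formE.
under [RHS]eq_Rintegral => y _ do rewrite sqr_expand.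
rewrite Rintegral_sum => [|j].
  apply: eq_bigr => j _; rewrite Rintegral_sum // mulr_suml.
  apply: eq_bigr => i _; rewrite RintegralZl //; last exact: (il i.+1 j.+1).
  by rewrite !mxE expectation.unlock /= mulrAC.
rewrite (_ : _ \o _ = fun y =>
    \sum_(i < k) ((v 0 i * v 0 j) * (l i.+1 y * l j.+1 y))%:E)%E.
  by apply: integrable_sum => // i _; apply: ill.
by apply/funext => y /=; rewrite sumEFin.
Qed.

Lemma second_moment_mx_psd k : NT_admissible P0 l ->
  forall v, 0 <= quad_form (second_moment_mx P0 l k) v.
Proof.
move=> adm v; rewrite quad_form_second_moment //.
by apply: Rintegral_ge0 => y _; apply: sqr_ge0.
Qed.

Lemma NT_mx_quad_form_gt0 k (u : 'rV[R]_k) : NT_admissible P0 l -> (0 < k)%N ->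
  u != 0 -> 0 < quad_form (NT_mx P0 l k) u.
Proof.
move=> adm k0; apply: quad_form_invmx_gt0; first exact: second_moment_mx_sym.
  by case: adm => _ _ _; apply.
exact: second_moment_mx_psd.
Qed.

Lemma NT_mx_eigenvalue_gt0 k i : NT_admissible P0 l -> (0 < i <= k)%N ->
  0 < ordered_eigenvalue (NT_mx P0 l k) i.
Proof.
move=> adm /[dup] /andP[i0 ik] hi.
apply: (@eigenvalue_invmx_gt0 _ _ (second_moment_mx P0 l k)).
- exact: second_moment_mx_sym.
- by case: adm => _ _ _; apply; apply: leq_trans ik.
- exact: second_moment_mx_psd.
- apply: eigenvalue_ordered_eigenvalue => //.
  by rewrite invmx_sym // second_moment_mx_sym.
Qed.

End second_moments.

(** * NT-statistics as continuous functions of the mean *)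

Section NT_statistic_of_the_mean.
Context {R : realType} {dY : measure_display} {YY : measurableType dY}.
Context (P0 : probability YY R) (l : nat -> {mfun YY >-> R}).

(** All the statistics with k <= K are functions of one and the same vector
    mean, the one to which the law of large numbers applies. *)
Lemma NT_stat_mean K k (kK : (k <= K)%N) (Y : nat -> YY) n : (0 < n)%N ->
  NT_stat P0 l Y n k = n%:R * quad_form (NT_mx P0 l k)
    (colsub (widen_ord kK) (n%:R^-1 *: \sum_(1 <= j < n.+1) lrow l K (Y j))).
Proof.
move=> n0; have n0' : 0 < n%:R :> R by rewrite ltr0n.
have -> : colsub (widen_ord kK)
    (n%:R^-1 *: \sum_(1 <= j < n.+1) lrow l K (Y j)) =
    (Num.sqrt n%:R)^-1 *: normalized_sum l k Y n.
  rewrite /normalized_sum scalerA -invfM -expr2 sqr_sqrtr ?ler0n //.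
  apply/rowP => i; rewrite !mxE !summxE; congr (_ * _).
  by apply: eq_bigr => j _; rewrite !mxE.
rewrite quad_formZ exprVn sqr_sqrtr ?ler0n // mulVKf ?lt0r_neq0 //.
Qed.

Lemma measurable_NT_stat {dO : measure_display} {Omega : measurableType dO}
    (Y : nat -> Omega -> YY) n k : (forall j, measurable_fun setT (Y j)) ->
  measurable_fun setT (fun w => NT_stat P0 l (Y ^~ w) n k).
Proof.
move=> mY; rewrite (_ : (fun w => _) = fun w => \sum_j (\sum_i
    normalized_sum l k (Y ^~ w) n 0 i * NT_mx P0 l k i j) *
    normalized_sum l k (Y ^~ w) n 0 j); last first.
  by apply/funext => w; rewrite -quad_formE.
have mx i : measurable_fun setT (fun w => normalized_sum l k (Y ^~ w) n 0 i).
  rewrite (_ : (fun w => _) = fun w =>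
      (Num.sqrt n%:R)^-1 * \sum_(1 <= j < n.+1) l i.+1 (Y j w)).
    apply: measurable_funM => //; apply: measurable_sum => j.
    exact: measurableT_comp.
  apply/funext => w; rewrite !mxE summxE; congr (_ * _).
  by apply: eq_bigr => j _; rewrite !mxE.
apply: measurable_sum => j; apply: measurable_funM => //.
by apply: measurable_sum => i; apply: measurable_funM.
Qed.

End NT_statistic_of_the_mean.

Lemma continuous_quad_form_colsub {R : numFieldType} {k K} (A : 'M[R]_k)
    (f : 'I_k -> 'I_K) :
  continuous (fun x : 'rV[R]_K => quad_form A (colsub f x)).
Proof.
rewrite (_ : (fun x => _) = fun x : 'rV[R]_K =>
    \sum_j (\sum_i x 0 (f i) * A i j) * x 0 (f j)); last first.
  apply/funext => x; rewrite quad_formE; apply: eq_bigr => j _.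
  by rewrite mxE; congr (_ * _); apply: eq_bigr => i _; rewrite mxE.
apply: continuous_big => [|j _]; first exact: add_continuous.
move=> x; apply: continuousM; last exact: coord_continuous.
move: x; apply: (continuous_big (op := +%R)) => [|i _]; first exact: add_continuous.
by move=> x; apply: continuousM; [exact: coord_continuous | exact: cst_continuous].
Qed.

(** * Events and their probabilities *)

Section measurability.
Context {dO : measure_display} {Omega : measurableType dO}.

Lemma measurable_set_bool (b : Omega -> bool) :
  measurable_fun setT b -> measurable [set w | b w].
Proof.
move=> mb; rewrite -[X in measurable X]setTI.
exact: (mb measurableT [set true] I).
Qed.

Lemma measurable_fun_has (I : Type) (b : I -> Omega -> bool) (s : seq I) :
  (forall i, measurable_fun setT (b i)) ->
  measurable_fun setT (fun w => has (b ^~ w) s).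
Proof.
by move=> mb; elim: s => [|i s IH] /=; [exact: measurable_cst | exact: measurable_or].
Qed.

Lemma measurable_fun_all (I : Type) (b : I -> Omega -> bool) (s : seq I) :
  (forall i, measurable_fun setT (b i)) ->
  measurable_fun setT (fun w => all (b ^~ w) s).
Proof.
by move=> mb; elim: s => [|i s IH] /=; [exact: measurable_cst | exact: measurable_and].
Qed.

Lemma measurable_norm_row_ge {R : realType} {k} (X : Omega -> 'rV[R]_k) (e : R) :
  0 < e -> (forall i, measurable_fun setT (fun w => X w 0 i)) ->
  measurable [set w | e <= `|X w|].
Proof.
move=> e0 mX.
rewrite (_ : [set _ | _] = ~` [set w | all (fun i => `|X w 0 i| < e) (enum 'I_k)]).
  apply/measurableC/measurable_set_bool/measurable_fun_all => i.
  apply: measurable_fun_ltr; last exact: measurable_cst.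
  exact: measurableT_comp.
have normE w : `|X w| = \big[Num.max/0]_ij `|X w ij.1 ij.2| by exact: mx_normrE.
apply/seteqP; split => w /=; rewrite normE.
  move=> h /allP lte; move: h; rewrite leNgt => /negP; apply.
  by apply/bigmax_ltP; split=> // -[i j] _ /=; rewrite ord1 lte // mem_enum.
rewrite leNgt => h; apply/negP => /bigmax_ltP[_ lte]; apply: h.
by apply/allP => i _; apply: (lte (0, i)).
Qed.

(** Monotonicity of P holds on measurable sets only, hence the two measurability
    conditions: they make 1 - P (B n) <= P (A n) <= 1 available. *)
Lemma probability_cvg1 {R : realType} (P : probability Omega R)
    (A B : nat -> set Omega) :
  (\forall n \near \oo, [/\ measurable (A n), measurable (B n) & ~` B n `<=` A n]) ->
  P (B n) @[n --> \oo] --> 0%E -> P (A n) @[n --> \oo] --> 1%E.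
Proof.
move=> AB B0.
apply: (@squeeze_cvge _ _ _ _ (fun n => 1 - P (B n))%E _ (cst 1%E)).
- near=> n; have [mA mB BA] :
      [/\ measurable (A n), measurable (B n) & ~` B n `<=` A n] by near: n.
  rewrite probability_le1 // andbT -probability_setC //.
  by apply: le_measure => //; rewrite inE //; apply: measurableC.
- rewrite -[X in _ --> X]sube0; apply: cvgeB => //; exact: cvg_cst.
- exact: cvg_cst.
Unshelve. all: by end_near. Qed.

End measurability.

(** * The selection rule *)

Section selection_rule.
Context {R : realType}.
Implicit Types (T pen : nat -> R) (d K : nat).

Lemma has_argmax_iota (f : nat -> R) d : (0 < d)%N ->
  has (fun k => all (fun j => f j <= f k) (iota 1 d)) (iota 1 d).
Proof.
move=> d0; have [k kd kmax] : exists2 k, k \in iota 1 d &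
    forall j, j \in iota 1 d -> f j <= f k.
  elim: d d0 => // -[_ _|d IH _]; first by exists 1%N => // j; rewrite inE => /eqP ->.
  have [k kd kmax] := IH isT.
  have -> : iota 1 d.+2 = rcons (iota 1 d.+1) d.+2.
    by rewrite -[in LHS](addn1 d.+1) iotaD cats1 add1n.
  have [h|h] := leP (f d.+2) (f k).
    exists k; first by rewrite mem_rcons inE kd orbT.
    by move=> j; rewrite mem_rcons inE => /orP[/eqP ->|/kmax].
  exists d.+2; first by rewrite mem_rcons mem_head.
  by move=> j; rewrite mem_rcons inE => /orP[/eqP ->|/kmax/le_trans/(_ (ltW h))].
by apply/hasP; exists k => //; apply/allP.
Qed.

Lemma head_filter (A : Type) (x0 : A) (a : pred A) s :
  has a s -> head x0 [seq x <- s | a x] = nth x0 s (find a s).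
Proof. by elim: s => //= x s IH; case: ifP => //= ax /IH. Qed.

(** As a maximizer exists, the selected index is the first of them, so it is at
    least K when none of 1, ..., K - 1 is a maximizer.  In this form the event
    S >= K is a finite combination of comparisons between statistics, hence measurable. *)
Lemma leq_selection T pen d K : (0 < d)%N -> (K <= d.+1)%N ->
  (K <= selection T pen d)%N =
  all (fun k => has (fun j => T k - pen k < T j - pen j) (iota 1 d)) (iota 1 K.-1).
Proof.
move=> d0 Kd; rewrite /selection.
set a := fun k => _.
have ha : has a (iota 1 d) := has_argmax_iota (fun j => T j - pen j) d d0.
rewrite head_filter // nth_iota; last first.
  by rewrite -[X in (_ < X)%N](size_iota 1 d) -has_find.
rewrite (_ : iota 1 K.-1 = take K.-1 (iota 1 d)); last first.
  by rewrite take_iota; congr iota; apply/esym/minn_idPl; case: K Kd.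
rewrite -[LHS]negbK -ltnNge.
rewrite (_ : (_ < _)%N = (find a (iota 1 d) < K.-1)%N); last by case: K {Kd}.
rewrite -(has_take _ ha) -all_predC; apply: eq_all => k /=.
by rewrite /a -has_predC; apply: eq_has => j /=; rewrite -ltNge.
Qed.

End selection_rule.

(** * Consistency of the selection rule *)

(** Finiteness of the index set matters: the supremum of an unbounded set is a
    default value. *)
Lemma finite_sup_ge {R : realType} (f : nat -> R) d k :
  (1 <= k <= d)%N -> f k <= sup [set f j | j in [set j | (1 <= j <= d)%N]].
Proof.
move=> kd; apply: ub_le_sup; last by exists k.
exists (\sum_(j < d.+1) `|f j|) => _ [j /andP[_ jd] <-].
rewrite (bigD1 (Ordinal (jd : j < d.+1)%N)) //= (le_trans (ler_norm _)) //.
by rewrite lerDl sumr_ge0.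
Qed.

Theorem proposition1 (R : realType)
    (dY : measure_display) (YY : measurableType dY)
    (dO : measure_display) (Omega : measurableType dO) (P : probability Omega R)
    (Y : nat -> {RV P >-> YY}) (l : nat -> {mfun YY >-> R})
    (P0 : probability YY R)
    (d : nat -> nat) (pen : nat -> nat -> R)
    (K : nat) (C_P : R)
    (dN : measure_display) (OmegaN : measurableType dN)
    (PN : probability OmegaN R) (Z : OmegaN -> 'rV[R]_K) :
  let mu : 'rV[R]_K := \row_(i < K) fine 'E_P[l i.+1 \o Y 1%N]%E in
  let lam (k i : nat) : R := ordered_eigenvalue (NT_mx P0 l k) i in
  let S (n : nat) (w : Omega) : nat :=
    selection (fun k => NT_stat P0 l (fun j => Y j w) n k)
              (fun k => pen k n) (d n) in
  NT_admissible P0 l ->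
  (forall n, (0 < n)%N -> (0 < d n)%N) ->
  is_penalty d pen ->
  (* Penalties may be negative, but not of order - n: otherwise a very negative
     pen 1 n, invisible in the supremum below, forces S = 1. *)
  (forall e : R, 0 < e -> \forall n \near \oo, - (e * n%:R) <= pen 1%N n) ->
  (forall i, (0 < i)%N -> forall B, measurable B ->
     distribution P (Y i) B = distribution P (Y 1%N) B) ->
  (forall i, (1 <= i)%N -> (i <= K)%N ->
     P.-integrable setT (EFin \o (l i \o Y 1%N))) ->
  cvg_in_probability P
    (fun n w => n%:R^-1 *: \sum_(1 <= j < n.+1) lrow l K (Y j w)) mu ->
  centered_normal_vector PN Z ->
  cvg_in_law P PN
    (fun n w => (Num.sqrt n%:R)^-1 *: \sum_(1 <= j < n.+1) (lrow l K (Y j w) - mu))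
    Z ->
  (1 <= K)%N ->
  (forall i, (1 <= i)%N -> (i < K)%N -> 'E_P[l i \o Y 1%N]%E = 0%E) ->
  'E_P[l K \o Y 1%N]%E = C_P%:E ->
  C_P != 0 ->
  d n @[n --> \oo] --> \oo ->
  sup [set pen k n / (n%:R * lam k k) | k in [set k | (1 <= k <= d n)%N]]
    @[n --> \oo] --> (0 : R) ->
  P [set w | (K <= S n w)%N] @[n --> \oo] --> 1%E.
Proof.
move=> mu lam S adm d0 [pen_incr _] pen1 _ _ xbar_mu _ _ K0 El0 ElK CP0 d_oo sup0.
pose L k : 'M[R]_k := NT_mx P0 l k.
pose q k (kK : (k <= K)%N) (x : 'rV[R]_K) := quad_form (L k) (colsub (widen_ord kK) x).
pose c := q K (leqnn K) mu.
have c0 : 0 < c.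
  apply: NT_mx_quad_form_gt0 => //; move: CP0; apply: contra_neq => /rowP.
  have K1 : (K.-1 < K)%N by rewrite prednK.
  by move=> /(_ (Ordinal K1)); rewrite !mxE /= prednK // ElK.
have q_mu0 k (kK : (k < K)%N) : q k (ltnW kK) mu = 0.
  rewrite /q (_ : colsub _ mu = 0) ?quad_form0 //; apply/rowP => i.
  by rewrite !mxE /= El0 //; apply: leq_ltn_trans kK.
have q_cont k (kK : (k <= K)%N) : q k kK x @[x --> mu] --> q k kK mu :=
  continuous_quad_form_colsub (L k) (widen_ord kK) mu.
have [e e0 q_near] : exists2 e, 0 < e & forall x, `|x - mu| < e ->
    forall k : 'I_K, c / 2 < q K (leqnn K) x - q k (ltnW (ltn_ord k)) x.
  have : \forall x \near mu, forall k : 'I_K,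
      c / 2 < q K (leqnn K) x - q k (ltnW (ltn_ord k)) x.
    refine (@filter_forall _ 'I_K (fun k => [set x |
      c / 2 < q K (leqnn K) x - q k (ltnW (ltn_ord k)) x]) _ (nbhs_filter mu) _) => k.
    have : q K (leqnn K) x - q k (ltnW (ltn_ord k)) x @[x --> mu] -->
        q K (leqnn K) mu - q k (ltnW (ltn_ord k)) mu.
      exact: (@cvgB R R^o _ _ _ (q K (leqnn K)) (q k _) _ _ (q_cont _ _) (q_cont _ _)).
    move=> /cvgr_gt; apply; rewrite q_mu0 -/c; lra.
  move=> /nbhs_normP[e /= e0 ball_e]; exists e => // x xe; apply: ball_e => /=.
  by rewrite distrC.
have lam0 : 0 < lam K K by apply: NT_mx_eigenvalue_gt0; rewrite ?K0 /=.
apply: (probability_cvg1 P _ (fun n => [set w | e <=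
    `|n%:R^-1 *: (\sum_(1 <= j < n.+1) lrow l K (Y j w)) - mu|])); last first.
  exact: xbar_mu.
near=> n.
have n0 : (0 < n)%N by near: n; exact: nbhs_infty_gt.
have nR0 : 0 < n%:R :> R by rewrite ltr0n.
have Kd : (K <= d n)%N.
  near: n; apply: (d_oo [set m | (K <= m)%N]); exact: nbhs_infty_ge.
(* The gap n * c / 2 between the statistics is shared equally between the
   upper bound on pen K n and the lower bound on pen 1 n. *)
have pen1_ge : - (c / 4 * n%:R) <= pen 1%N n by near: n; apply: pen1; lra.
have penK_lt : pen K n < c / 4 * n%:R.
  have supn : sup [set pen k n / (n%:R * lam k k) |
      k in [set k | (1 <= k <= d n)%N]] < c / 4 / lam K K.
    by near: n; apply: (cvgr_lt (0 : R)) => //; rewrite divr_gt0 // divr_gt0.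
  have Kn : (1 <= K <= d n)%N by rewrite K0.
  have := le_lt_trans
    (finite_sup_ge (fun k => pen k n / (n%:R * lam k k)) _ _ Kn) supn.
  rewrite ltr_pdivrMr ?mulr_gt0 // (_ : _ * (_ * _) = c / 4 * n%:R) //; field.
  exact: lt0r_neq0.
have pen_lt k : (1 <= k < K)%N -> pen K n - pen k n <= c / 2 * n%:R.
  move=> /andP[k1 kK].
  have : pen 1%N n <= pen k n.
    move: k1; rewrite leq_eqVlt => /predU1P[<- //|k1].
    by apply/ltW/pen_incr => //; apply: leq_trans Kd; apply: ltnW.
  lra.
have SE w : (K <= S n w)%N = all (fun k => has (fun j =>
    NT_stat P0 l (fun j => Y j w) n k - pen k n <
    NT_stat P0 l (fun j => Y j w) n j - pen j n) (iota 1 (d n))) (iota 1 K.-1).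
  by apply: leq_selection; rewrite ?d0 // ltnW.
split.
- (* S takes its values through a filtered list, so measurability is read off
     the comparisons that characterize K <= S. *)
  rewrite (_ : [set _ | _] = [set w | all (fun k => has (fun j =>
    NT_stat P0 l (fun j => Y j w) n k - pen k n <
    NT_stat P0 l (fun j => Y j w) n j - pen j n) (iota 1 (d n))) (iota 1 K.-1)]).
    apply/measurable_set_bool/measurable_fun_all => k.
    apply: measurable_fun_has => j; apply: measurable_fun_ltr;
      apply: measurable_funB => //; exact: measurable_NT_stat.
  by apply/funext => w /=; rewrite SE.
- apply: measurable_norm_row_ge => // i.
  rewrite (_ : (fun w => _) = fun w =>
     n%:R^-1 * (\sum_(1 <= j < n.+1) l i.+1 (Y j w)) - mu 0 i).
    apply: measurable_funB => //; apply: measurable_funM => //.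
    by apply: measurable_sum => j; apply: measurableT_comp.
  apply/funext => w; rewrite 3!mxE [in RHS]mxE summxE !mxE; congr (_ * _ - _).
  by apply: eq_bigr => j _; rewrite mxE.
- move=> w /= /negP; rewrite -ltNge => /q_near qw; rewrite SE.
  apply/allP => k; rewrite mem_iota add1n prednK // => /andP[k1 kK].
  apply/hasP; exists K; first by rewrite mem_iota add1n K0 ltnS.
  rewrite (NT_stat_mean _ _ _ _ (leqnn K)) // (NT_stat_mean _ _ _ _ (ltnW kK)) //.
  have := pen_lt k; rewrite k1 kK => /(_ isT).
  have := qw (Ordinal kK); rewrite /= (bool_irrelevance (ltnW _) (ltnW kK)).
  rewrite -/(q K _ _) -/(q k _ _) -(ltr_pM2r nR0); lra.
Unshelve. all: by end_near. Qed.
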